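(* Let $(X,T)$ be a dynamical system and $x\in X$. Then $x$ is $\mathcal{AP}$-recurrent if and only if $(\overline{\mathrm{Orb}(x,T)},T)$ is a van der Waerden system.
   Context: A (topological) dynamical system $(X,T)$ consists of a (nonempty) compact metric space and a continuous map $T\colon X\to X$. $\mathbb{N}$ is the set of positive integers and $\mathrm{Orb}(x,T)=\{T^nx:n=0,1,2,\dots\}$. A set $F\subset\mathbb{N}$ is an AP-set if for every $d\ge1$ there are $a,n\in\mathbb{N}$ with $\{a,a+n,\dots,a+dn\}\subset F$. For $U\subset X$, $N(x,U)=\{n\in\mathbb{N}:T^nx\in U\}$. A point $x\in X$ is $\mathcal{AP}$-recurrent if $N(x,U)$ is an AP-set for every open neighborhood $U$ of $x$. A dynamical system $(Z,R)$ is a van der Waerden system if for every non-empty open set $U\subset Z$ and every $d\in\mathbb{N}$ there exists $n\in\mathbb{N}$ such that $U\cap R^{-n}U\cap R^{-2n}U\cap\dots\cap R^{-dn}U\ne\emptyset$. *)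

(* Defs.v *)
From HB Require Import structures.
From mathcomp Require Import all_boot all_order all_algebra.
From mathcomp Require Import all_classical all_reals all_analysis.

Set Implicit Arguments.
Unset Strict Implicit.
Unset Printing Implicit Defensive.

Import Order.TTheory GRing.Theory Num.Theory.

Local Open Scope classical_set_scope.

(* A subset of a metric space is a metric space for the induced distance; the
   library only provides the induced pseudometric on the type of its points. *)
Section subset_metric.
Context {R : realType} {X : metricType R} (A : set X).

Let dist (y z : A) : R := mdist (set_val y) (set_val z).

Let dist_ge0 y z : (0 <= dist y z)%R.
Proof. exact: mdist_ge0. Qed.

Let dist_positivity y z : dist y z = 0%R -> y = z.
Proof. by move=> /mdist_positivity /val_inj. Qed.

Let ballEdist (y : A) (e : R) : ball y e = [set z | (dist y z < e)%R].
Proof.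
have -> : ball y e = set_val @^-1` ball (set_val y) e by [].
by rewrite ballEmdist.
Qed.

HB.instance Definition _ := PseudoMetric_isMetric.Build R (set_type A)
  dist_ge0 dist_positivity ballEdist.

End subset_metric.

(* All indices d, a, n below range over the positive integers; only orbits
   include the iterate of rank 0. *)

Definition dynamical_system (R : realType) (X : metricType R) (T : X -> X) :=
  [/\ [set: X] !=set0, compact [set: X] & continuous T].

Definition orbit (X : Type) (T : X -> X) (x : X) : set X :=
  range (fun n : nat => iter n T x).

Definition AP_set (F : set nat) :=
  forall d : nat, (0 < d)%N -> exists a n : nat,
    [/\ (0 < a)%N, (0 < n)%N & forall i : nat, (i <= d)%N -> F (a + i * n)%N].

Definition return_times (X : Type) (T : X -> X) (x : X) (U : set X) : set nat :=
  [set n | (0 < n)%N /\ U (iter n T x)].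

Definition AP_recurrent (X : topologicalType) (T : X -> X) (x : X) :=
  forall U : set X, open U -> U x -> AP_set (return_times T x U).

(* The term i = 0 of the intersection is U itself. *)
Definition van_der_Waerden_system (R : realType) (Z : metricType R)
    (S : Z -> Z) :=
  dynamical_system S /\
  forall U : set Z, open U -> U !=set0 ->
    forall d : nat, (0 < d)%N -> exists2 n : nat, (0 < n)%N &
      \bigcap_(i in [set i : nat | (i <= d)%N]) (iter (i * n) S @^-1` U)
        !=set0.

Section orbit_closure.
Context {R : realType} {X : metricType R}.

Lemma orbit_closure_invariant (T : X -> X) (hT : dynamical_system T) (x : X) :
  set_fun (closure (orbit T x)) (closure (orbit T x)) T.
Proof.
case: hT => _ _ cT y cly B /cT /cly [_ [[n _ <-] Bn]].
by exists (iter n.+1 T x); split; first by exists n.+1.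
Qed.

Definition orbit_closure_map (T : X -> X) (hT : dynamical_system T) (x : X)
    (y : closure (orbit T x)) : closure (orbit T x) :=
  exist _ (T (set_val y))
    (mem_set (orbit_closure_invariant hT (set_valP y))).

Lemma orbit_closure_dynamical_system (T : X -> X) (hT : dynamical_system T)
  (x : X) : dynamical_system (@orbit_closure_map T hT x).
Proof.
have [_ cX cT] := hT; set A := closure (orbit T x); split.
- have Ax : A x by apply: subset_closure; exists 0%N.
  by exists (exist _ x (mem_set Ax)).
- have cA : compact A.
    by apply: (subclosed_compact _ cX) => //; exact: closed_closure.
  move=> F FF _.
  have FA : (set_val @ F) A.
    by apply: (@filterS _ F _ setT) filterT => z _; exact: set_valP.
  have [y [Ay cly]] := cA _ (fmap_proper_filter set_val FF) FA.
  exists (exist _ y (mem_set Ay)); split=> // B C FB.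
  move=> [_ [[W oW <-] /= Wy WC]].
  have FB' : (set_val @ F) (set_val @` B).
    by apply: (@filterS _ F _ B) FB => z Bz; exists z.
  have [_ [[z Bz <-] Wz]] := cly _ W FB' (open_nbhs_nbhs (conj oW Wy)).
  by exists z; split=> //; exact: WC.
- move=> y B [_ [[W oW <-] /= Wy WB]].
  have TW : nbhs (set_val y) (T @^-1` W).
    by apply: cT; exact: (open_nbhs_nbhs (conj oW Wy)).
  have : nbhs y (set_val @^-1` (T @^-1` W)).
    exact: (@initial_continuous (set_type A) X set_val y _ TW).
  by apply: filterS => z Wz; exact: WB.
Qed.

End orbit_closure.

Arguments orbit_closure_map {R X T} hT x.

(* Main.v *)
Require Import Defs.
From mathcomp Require Import all_boot all_order all_algebra.
From mathcomp Require Import all_classical all_reals all_analysis.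

(** The orbit of [x] is dense in its closure [Z], so both properties can be
    read on arithmetic progressions of times along this single orbit.

    If [x] is AP-recurrent and [U] is a nonempty open subset of [Z], density
    gives [m] with [T^m x] in [U].  The neighborhood [T^-m U] of [x] is visited
    at times [a, a + n, ..., a + d n], and then [y = T^(a + m) x] has
    [y, T^n y, ..., T^(d n) y] in [U].

    Conversely, if [Z] is a van der Waerden system and [U] is a neighborhood of
    [x], then the points [y] of [U] with [y, T^n y, ..., T^(d n) y] in [U] form
    an open set, nonempty for a suitable [n], so by density it contains some
    [T^a x]; hence the orbit is in [U] at the times [a, a + n, ..., a + d n],
    which are return times as soon as [a] is positive.

    Both arguments take place inside [Z] ([dense_orbit_AP_recurrentP]); AP
    recurrence of [x] in [X] and in [Z] agree because the open subsets of [Z]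
    are the traces of those of [X] ([AP_recurrent_orbit_closure]). *)

Set Implicit Arguments.
Unset Strict Implicit.
Unset Printing Implicit Defensive.

Local Open Scope classical_set_scope.

Lemma open_preimage_iter (Z : topologicalType) (S : Z -> Z) (n : nat)
    (U : set Z) :
  continuous S -> open U -> open (iter n S @^-1` U).
Proof.
move=> cS; elim: n => [//|n IHn] in U * => oU.
by apply: (IHn (S @^-1` U)); apply: open_comp oU => y _; exact: cS.
Qed.

Lemma open_progression_starts (Z : topologicalType) (S : Z -> Z) (U : set Z)
    (d n : nat) :
  continuous S -> open U ->
  open (\bigcap_(i in [set i : nat | (i <= d)%N]) (iter (i * n) S @^-1` U)).
Proof.
move=> cS oU; rewrite -closedC setC_bigcap; apply: closed_bigcup.
  exact: (finite_II d.+1).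
by move=> i _; rewrite closedC; exact: open_preimage_iter.
Qed.

(** The core of the equivalence, for one map on one space: density of the orbit
    moves a progression between an arbitrary open set and the orbit of [p]. *)
Lemma dense_orbit_AP_recurrentP (Z : topologicalType) (S : Z -> Z) (p : Z) :
  continuous S -> dense (Defs.orbit S p) ->
  AP_recurrent S p <->
  forall U : set Z, open U -> U !=set0 ->
    forall d : nat, (0 < d)%N -> exists2 n : nat, (0 < n)%N &
      \bigcap_(i in [set i : nat | (i <= d)%N]) (iter (i * n) S @^-1` U)
        !=set0.
Proof.
move=> cS dp; split=> [recp U oU U0 d d0|vdW U oU Up d d0].
- have [z [Um [m _ eqm]]] := dp U U0 oU; rewrite -{z}eqm in Um.
  have [a [n [a0 n0 an]]] := recp _ (open_preimage_iter m cS oU) Um d d0.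
  exists n => //; exists (iter (m + a) S p) => i /an[_].
  by rewrite /preimage/= -!iterD (addnC (i * n)%N) addnA.
- (* Density may return the starting time [a = 0], which is not a return time.
     Asking for one more term allows starting from [a + n] instead. *)
  have [n n0 Vn] := vdW U oU (ex_intro _ p Up) d.+1 isT.
  have [z [Va [a _ eqz]]] := dp _ Vn (open_progression_starts d.+1 n cS oU).
  exists (a + n)%N, n; split=> // [|i id]; first by rewrite addn_gt0 n0 orbT.
  split; first by rewrite !addn_gt0 n0 orbT.
  have := Va i.+1 id.
  by rewrite /preimage/= -eqz -iterD mulSn addnC addnA.
Qed.

Section orbit_closure_point.
Context {R : realType} {X : metricType R} (T : X -> X).
Context (hT : dynamical_system T) (x : X).

Let S := orbit_closure_map hT x.

Lemma val_iter_orbit_closure_map (n : nat) (y : closure (Defs.orbit T x)) :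
  set_val (iter n S y) = iter n T (set_val y).
Proof. by elim: n => //= n <-. Qed.

Lemma dense_orbit_closure (p : closure (Defs.orbit T x)) :
  set_val p = x -> dense (Defs.orbit S p).
Proof.
move=> px U [y Uy] [W oW eqU]; rewrite -{U}eqU in Uy *.
have [_ [[m _ <-] Wm]] := set_valP y W (open_nbhs_nbhs (conj oW Uy)).
exists (iter m S p); split; last by exists m.
by rewrite /preimage/= val_iter_orbit_closure_map px.
Qed.

Lemma AP_recurrent_orbit_closure (p : closure (Defs.orbit T x)) :
  set_val p = x -> AP_recurrent T x <-> AP_recurrent S p.
Proof.
move=> px.
have times W : return_times S p (set_val @^-1` W) = return_times T x W.
  by apply/funext => n; rewrite /return_times/preimage/=
    val_iter_orbit_closure_map px.
split=> recx.
- by move=> _ [W oW <-] Wp; rewrite times; apply: recx => //; rewrite -px.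
- move=> W oW Wx; rewrite -times; apply: recx; first by exists W.
  by rewrite /preimage/= px.
Qed.

End orbit_closure_point.

Theorem proposition4p9 (R : realType) (X : metricType R) (T : X -> X)
    (hT : dynamical_system T) (x : X) :
  AP_recurrent T x <-> van_der_Waerden_system (orbit_closure_map hT x).
Proof.
have Zx : closure (Defs.orbit T x) x by apply: subset_closure; exists 0%N.
pose p : closure (Defs.orbit T x) := exist _ x (mem_set Zx).
have dsS := orbit_closure_dynamical_system hT x; have [_ _ cS] := dsS.
have px : set_val p = x by [].
rewrite (AP_recurrent_orbit_closure hT px).
rewrite (dense_orbit_AP_recurrentP cS (dense_orbit_closure hT px)).
by split=> [|[]].
Qed.
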